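(* Let $E$ be an $n$-dimensional vector space over a field $\mathbb{F}$ and let $\mathcal{B}$ be a family of subspaces of $E$ that satisfies the axioms (B1), (B2) and (B4). Then $\mathcal{B}$ satisfies (B3).
   Context: $n$ is a positive integer, $\mathbb{F}$ is an arbitrary field, and $\mathcal{L}(E)$ denotes the lattice of all subspaces of $E$. For a family $\mathcal{A}\subseteq\mathcal{L}(E)$ and $X\in\mathcal{L}(E)$, $\max(X,\mathcal{A})$ is the set of members of $\mathcal{A}$ contained in $X$ that have the largest dimension among all members of $\mathcal{A}$ contained in $X$, and $X\cap\mathcal{A}:=\{X\cap A: A\in\mathcal{A}\}$. (So $\max(E,A\cap\mathcal{B})$ is the set of intersections $A\cap B$, $B\in\mathcal{B}$, of maximal dimension.) Basis axioms for $\mathcal{B}\subseteq\mathcal{L}(E)$: (B1) $\mathcal{B}\neq\emptyset$. (B2) For all $B_1,B_2\in\mathcal{B}$, if $B_1\subseteq B_2$, then $B_1=B_2$. (B3) For all $B_1,B_2\in\mathcal{B}$ and for every subspace $A$ of codimension $1$ in $B_1$ satisfying $B_1\cap B_2\subseteq A$, there is a $1$-dimensional subspace $y$ of $B_2$ such that $A+y\in\mathcal{B}$. (B4) For all $A,B\in\mathcal{L}(E)$ and $I,J\in\mathcal{L}(E)$ such that $I\in\max(E,A\cap\mathcal{B})$ and $J\in\max(E,B\cap\mathcal{B})$, there exists $K\in\max(E,(A+B)\cap\mathcal{B})$ such that $K\subseteq I+J$. *)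

(* Defs.v *)
(* Families of subspaces are arbitrary [Prop]-valued sets: [{vspace E}] is
   infinite in general. *)
From HB Require Import structures.
From mathcomp Require Import all_boot all_order all_algebra.
From mathcomp Require Import classical_sets.

Set Implicit Arguments.
Unset Strict Implicit.
Unset Printing Implicit Defensive.

Local Open Scope classical_set_scope.

Section BasisAxioms.
Variables (F : fieldType) (E : vectType F).
Implicit Types (X A B I J K y : {vspace E}) (AA BB : set {vspace E}).

Definition max_members X AA : set {vspace E} :=
  [set Y | [/\ AA Y, (Y <= X)%VS &
            forall Z, AA Z -> (Z <= X)%VS -> (\dim Z <= \dim Y)%N]].

Definition cap_family X AA : set {vspace E} := capv X @` AA.

Definition axiom_B1 BB : Prop := BB !=set0.

Definition axiom_B2 BB : Prop :=
  forall B1 B2, BB B1 -> BB B2 -> (B1 <= B2)%VS -> B1 = B2.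

Definition axiom_B3 BB : Prop :=
  forall B1 B2, BB B1 -> BB B2 ->
  forall A, (A <= B1)%VS -> \dim B1 = (\dim A + 1)%N -> (B1 :&: B2 <= A)%VS ->
  exists y, [/\ (y <= B2)%VS, \dim y = 1%N & BB (A + y)%VS].

Definition axiom_B4 BB : Prop :=
  forall A B I J,
    max_members fullv (cap_family A BB) I ->
    max_members fullv (cap_family B BB) J ->
  exists2 K, max_members fullv (cap_family (A + B)%VS BB) K & (K <= I + J)%VS.

End BasisAxioms.

(* Main.v *)
Require Import Defs.
From HB Require Import structures.
From mathcomp Require Import all_boot all_order all_algebra.
From mathcomp Require Import boolp classical_sets.

(** Call a largest intersection [X :&: B], with [B] in the family, a maximal
    trace on [X].  The argument is the subspace version of greedy augmentation
    in a matroid: let [I] be a maximal trace on [X] and enlarge [X] by one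
    vector [x] of a subspace [W] at a time.  By (B4), applied to [X] and the
    line of [x], some maximal trace on the enlarged space lies in [I + <[x]>].
    So either [I] is still a maximal trace, or [I + <[x]>] is itself a trace
    and hence lies in a member of the family.  If some trace on [X + W] is
    larger than [I], the second case must occur before [X + W] is reached
    ([augmentation]).

    Augmentation is used twice.  A member [B] is a maximal trace on itself; if
    another member were larger, augmenting [B] inside the whole space would put
    [B] strictly inside a member, against (B2).  So all members have the same
    dimension ([equidimensional]).  For (B3), the hyperplane [A] of [B1] is a
    maximal trace on itself, and [B2] is a larger trace on [A + B2].  Augmenting
    [A] by vectors of [B2] gives a line [y] of [B2] such that [A + y] lies in a
    member, and [A + y] is that member because both have the dimension of [B1].
    *)

Set Implicit Arguments.
Unset Strict Implicit.
Unset Printing Implicit Defensive.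

Local Open Scope classical_set_scope.

Section Augmentation.
Variables (F : fieldType) (E : vectType F).
Implicit Types (A B I J K U W X Y Z : {vspace E}) (AA BB : set {vspace E}).

(** Dimensions are bounded by that of the whole space, so replacing a member by
    a larger one terminates. *)
Lemma max_members_exists AA Y : AA Y -> max_members fullv AA !=set0.
Proof.
have [m] := ubnP (\dim {:E} - \dim Y)%N.
elim: m Y => // m IHm Y lt_codim AAY.
have [[Z AAZ ltYZ]|noZ] := EM (exists2 Z, AA Z & (\dim Y < \dim Z)%N).
  apply: IHm AAZ; rewrite -ltnS; apply: leq_trans lt_codim; rewrite ltnS.
  exact: ltn_sub2l (leq_trans ltYZ (dimvS (subvf Z))) ltYZ.
exists Y; split=> [//||Z AAZ _]; first exact: subvf.
by rewrite leqNgt; apply/negP => ltYZ; apply: noZ; exists Z.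
Qed.

Lemma max_trace_self BB A B :
  BB B -> (A <= B)%VS -> max_members fullv (cap_family A BB) A.
Proof.
move=> BBB sAB; split; first by exists B => //; apply/capv_idPl.
  exact: subvf.
by move=> _ [C _ <-] _; rewrite dimvS ?capvSl.
Qed.

Lemma max_trace_extend BB X Y I K :
    max_members fullv (cap_family X BB) I ->
    max_members fullv (cap_family Y BB) K ->
    (X <= Y)%VS -> (\dim K <= \dim I)%N ->
  max_members fullv (cap_family Y BB) I.
Proof.
move=> [[B BBB <-] _ _] [_ _ maxK] sXY leKI.
have trY : cap_family Y BB (Y :&: B)%VS by exists B.
have eqI : (X :&: B)%VS = (Y :&: B)%VS.
  apply/eqP; rewrite eqEdim capvS //=.
  exact: leq_trans (maxK _ trY (subvf _)) leKI.
split; [by rewrite eqI | exact: subvf |].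
by move=> Z trZ sZ; apply: leq_trans (maxK Z trZ sZ) leKI.
Qed.

(** The axiom (B4) for [X] and a line: one new vector either leaves [I] maximal
    or enlarges it by exactly that vector. *)
Lemma max_trace_add_line BB X I x :
    axiom_B4 BB -> max_members fullv (cap_family X BB) I ->
  max_members fullv (cap_family (X + <[x]>) BB) I \/
  (x \notin I /\ exists2 B, BB B & (I + <[x]> <= B)%VS).
Proof.
move=> hB4 maxI; have [[B BBB _] _ _] := maxI.
have trx : cap_family <[x]>%VS BB (<[x]> :&: B)%VS by exists B.
have [J maxJ] := max_members_exists trx.
have [K maxK sKIJ] := hB4 _ _ _ _ maxI maxJ.
have sKIx : (K <= I + <[x]>)%VS.
  apply: subv_trans sKIJ _; apply: addvS => //.
  by have [[C _ <-] _ _] := maxJ; apply: capvSl.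
have [leKI|ltIK] := leqP (\dim K) (\dim I).
  by left; apply: max_trace_extend maxI maxK (addvSl _ _) leKI.
right; split.
  apply: contraL ltIK; rewrite -leqNgt memvE => sxI.
  by apply: dimvS; rewrite (addv_idPl sxI) in sKIx.
have [[C BBC eqK] _ _] := maxK; exists C => //.
(* A line adds at most one dimension, so [K], being larger than [I], fills
   [I + <[x]>]. *)
suff <- : K = (I + <[x]>)%VS by rewrite -eqK capvSr.
apply/eqP; rewrite eqEdim sKIx /=; apply: leq_trans ltIK.
apply: leq_trans (dimv_add_leqif _ _) _.
by rewrite -addn1 leq_add2l dim_vline leq_b1.
Qed.

(** Adding vectors of [W] to [X] one by one ends at [X + W], where [I] is not
    maximal; so some vector on the way enlarges [I]. *)
Lemma augmentation BB X W I B :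
    axiom_B4 BB -> max_members fullv (cap_family X BB) I ->
    BB B -> (\dim I < \dim ((X + W) :&: B))%N ->
  exists x, [/\ x \in W, x \notin I &
                exists2 C, BB C & (I + <[x]> <= C)%VS].
Proof.
move=> hB4 + BBB; have [m] := ubnP (\dim {:E} - \dim X)%N.
elim: m X => // m IHm X lt_codim maxI ltI.
have [sWX|/subvPn[x Wx nXx]] := boolP (W <= X)%VS.
  have [_ _ maxdim] := maxI.
  have trX : cap_family X BB (X :&: B)%VS by exists B.
  have := maxdim _ trX (subvf _); rewrite leqNgt.
  by rewrite -{1}(addv_idPl sWX) ltI.
have [maxI'|[nIx memC]] := max_trace_add_line x hB4 maxI; last by exists x.
have ltX : (\dim X < \dim (X + <[x]>))%N.
  rewrite ltnNge; apply: contra nXx => le_dim.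
  have /eqP eqX : X == (X + <[x]>)%VS by rewrite eqEdim addvSl.
  by rewrite memvE eqX addvSr.
apply: IHm maxI' _.
  rewrite -ltnS; apply: leq_trans lt_codim; rewrite ltnS.
  exact: ltn_sub2l (leq_trans ltX (dimvS (subvf _))) ltX.
apply: leq_trans ltI _; apply: dimvS; apply: capvS => //.
by apply: addvS => //; apply: addvSl.
Qed.

(** A member smaller than another one could be augmented inside the whole
    space, which (B2) forbids. *)
Lemma equidimensional BB B C :
  axiom_B2 BB -> axiom_B4 BB -> BB B -> BB C -> \dim B = \dim C.
Proof.
move=> hB2 hB4.
suff le_dim Y Z : BB Y -> BB Z -> (\dim Z <= \dim Y)%N.
  by move=> BBB BBC; apply/eqP; rewrite eqn_leq !le_dim.
move=> BBY BBZ; rewrite leqNgt; apply/negP => ltYZ.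
have maxY := max_trace_self BBY (subvv Y).
have [|x [_ nYx [K BBK sYxK]]] := @augmentation _ _ fullv _ Z hB4 maxY BBZ.
  by rewrite (addv_idPr (subvf Y)) capfv.
have eqYK := hB2 _ _ BBY BBK (subv_trans (addvSl _ _) sYxK).
by case/negP: nYx; rewrite memvE eqYK; apply: subv_trans (addvSr _ _) sYxK.
Qed.

End Augmentation.

Theorem theorem17 (n : nat) (n_gt0 : (0 < n)%N) (F : fieldType) (E : vectType F)
    (dimE : \dim {:E}%VS = n) (BB : set {vspace E})
    (hB1 : axiom_B1 BB) (hB2 : axiom_B2 BB) (hB4 : axiom_B4 BB) :
  axiom_B3 BB.
Proof.
move=> B1 B2 BB1 BB2 A sAB1 dimB1 _.
have maxA := max_trace_self BB1 sAB1.
have [|x [B2x nAx [C BBC sAxC]]] := @augmentation _ _ _ _ B2 _ _ hB4 maxA BB2.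
  rewrite (capv_idPr (addvSr A B2)) -(equidimensional hB2 hB4 BB1 BB2).
  by rewrite dimB1 addn1.
exists <[x]>%VS; split; first by rewrite -memvE.
  by rewrite dim_vline; case: eqP nAx => // ->; rewrite mem0v.
suff -> : (A + <[x]>)%VS = C by [].
apply/eqP; rewrite eqEdim sAxC -(equidimensional hB2 hB4 BB1 BBC) dimB1 addn1.
rewrite ltnNge; apply: contra nAx => le_dim.
have /eqP eqA : A == (A + <[x]>)%VS by rewrite eqEdim addvSl.
by rewrite memvE eqA addvSr.
Qed.
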